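(* Assume $\alpha=2$ and the far-destination approximation (every relay–destination distance equals $d$), and condition on there being exactly $N\ge1$ relays, i.i.d. uniform in the disc $\mathcal D$ of radius $R_{\mathcal D}$ centred at the source. With distributed beamforming by the set $\tilde{\mathcal S}=\{i: x_i>\epsilon\}$ of relays that decode, the destination SNR is $$SNR_{\tilde{\mathcal S}}=Px_0+\eta\sum_{i\in\tilde{\mathcal S}} y_i\,(Px_i-\tau),$$ and the outage probability is $\mathcal{P}_N(P)=\mathcal{P}\big(SNR_{\tilde{\mathcal S}}<\tau\big)$. Then distributed beamforming achieves the maximum diversity gain $N+1$: $-\lim_{P\to\infty}\frac{\log\mathcal{P}_N(P)}{\log P}=N+1$.
   Context: Source at origin, destination at distance $d>0$. For relay $i$ with source distance $d_i$: $x_i=|h_i|^2/(1+d_i^2)$, $y_i=|g_i|^2/(1+d^2)$; $x_0=|h_d|^2/(1+d^2)$; all fading coefficients $h_d,h_i,g_i$ are independent $\mathcal{CN}(0,1)$ and independent of locations. Transmit power $P>0$, target rate $R>0$, $\tau=2^{2R}-1$, $\epsilon=\tau/P$, energy harvesting efficiency $\eta\in(0,1]$ (relay $i$, if $x_i>\epsilon$, has harvested power $\eta(Px_i-\tau)$). Outage means $\tfrac12\log_2(1+SNR_{\tilde{\mathcal S}})<R$. *)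

(* Defs.v *)
From HB Require Import structures.
From mathcomp Require Import all_boot all_order all_algebra.
From mathcomp Require Import all_classical all_reals all_analysis.
Set Implicit Arguments. Unset Strict Implicit. Unset Printing Implicit Defensive.
Import Order.TTheory GRing.Theory Num.Theory numFieldNormedType.Exports.
Local Open Scope classical_set_scope.
Local Open Scope ring_scope.

(* squared Euclidean norm of a point of R^2 = C (pairs (Re, Im) or (x, y)) *)
Definition normsq {R : realType} (z : R * R) : R := z.1 ^+ 2 + z.2 ^+ 2.

Definition leb2 {R : realType} := ((@lebesgue_measure R) \x (@lebesgue_measure R))%E.

(* Z has the circularly-symmetric complex Gaussian law CN(0,1), z = (Re, Im):
   density (1/pi) exp(-|z|^2) w.r.t. Lebesgue measure on the plane. *)
Definition is_CN01 {d} {T : measurableType d} {R : realType}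
  (P : probability T R) (Z : T -> R * R) : Prop :=
  forall B : set (R * R), measurable B ->
    P (Z @^-1` B) = (\int[leb2]_(z in B) (expR (- normsq z) / pi)%:E)%E.

Definition disc {R : realType} (RD : R) : set (R * R) := [set z | normsq z <= RD ^+ 2].

Definition is_unif_disc {d} {T : measurableType d} {R : realType}
  (P : probability T R) (RD : R) (L : T -> R * R) : Prop :=
  forall B : set (R * R), measurable B ->
    P (L @^-1` B) = (leb2 (B `&` disc RD) * ((pi * RD ^+ 2)^-1)%:E)%E.

Definition mutually_independent {d} {T : measurableType d} {R : realType}
  (P : probability T R) {I : finType} (Z : I -> T -> R * R) : Prop :=
  forall B : I -> set (R * R), (forall i, measurable (B i)) ->
    P (\bigcap_(i in [set: I]) (Z i @^-1` B i)) = (\prod_(i : I) P (Z i @^-1` B i))%E.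

Definition relay_family {T : Type} {R : realType} {N : nat}
  (hd : T -> R * R) (h g L : 'I_N -> T -> R * R) (k : option ('I_3 * 'I_N)) : T -> R * R :=
  match k with
  | None => hd
  | Some (j, i) => if nat_of_ord j == 0%N then h i
                   else if nat_of_ord j == 1%N then g i else L i
  end.

Definition tau_of {R : realType} (Rt : R) : R := (2 : R) `^ (2 * Rt) - 1.

Definition SNR_DB {T : Type} {R : realType} {N : nat} (Rt eta dist p : R)
  (hd : T -> R * R) (h g L : 'I_N -> T -> R * R) (t : T) : R :=
  let tau := tau_of Rt in
  let eps := tau / p in
  let x0 := normsq (hd t) / (1 + dist ^+ 2) in
  let x i := normsq (h i t) / (1 + normsq (L i t)) in
  let y i := normsq (g i t) / (1 + dist ^+ 2) in
  p * x0 + eta * \sum_(i < N | eps < x i) y i * (p * x i - tau).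

Definition outage {d} {T : measurableType d} {R : realType} (P : probability T R) {N : nat}
  (Rt eta dist p : R) (hd : T -> R * R) (h g L : 'I_N -> T -> R * R) : R :=
  fine (P [set t | SNR_DB Rt eta dist p hd h g L t < tau_of Rt]).

(* Main.v *)
(* With s of order 1/p, outage contains the event that |h_d|^2 and all |h_i|^2
   are at most s (no relay decodes), of probability at least c p^-(N+1).
   Conversely, since the terms of the SNR are nonnegative, outage forces
   |h_d|^2 <= C s and, for every relay, |h_i|^2 <= s or |h_i|^2 |g_i|^2 <= s.
   Writing s = r^(k+1), the latter region is covered by k+2 rectangles
   {|h_i|^2 <= r^j, |g_i|^2 <= r^(k-j)}, each of probability at most 16 r^k, so
   a union bound over the choices of one rectangle per relay gives
   C_k p^-(1 + N k/(k+1)); let k tend to infinity. *)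
Require Import Defs.
From HB Require Import structures.
From mathcomp Require Import all_boot all_order all_algebra.
From mathcomp Require Import all_classical all_reals all_analysis.
From mathcomp Require Import measurable_realfun.
From mathcomp Require Import ring lra.
Import Order.TTheory GRing.Theory Num.Theory numFieldNormedType.Exports.
Local Open Scope classical_set_scope.
Local Open Scope ring_scope.

(** * From power-law bounds to the logarithmic limit *)

(** Taking logarithms turns constants into terms that vanish after division by [ln p]. The upper
    bound may lose any [e > 0] in the exponent, which is what the rectangle covering below
    delivers. *)
Lemma cvg_opp_ln_div_ln (R : realType) (f : R -> R) (l c : R) :
  0 < c -> (\forall p \near +oo, c * p `^ (- l) <= f p) ->
  (forall e, 0 < e -> exists2 C, 0 < C &
     \forall p \near +oo, f p <= C * p `^ (- (l - e))) ->
  - (ln (f p) / ln p) @[p --> +oo] --> l.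
Proof.
move=> c0 fge fle; apply/cvgrPdist_le => e e0.
have e20 : 0 < e / 2 by rewrite divr_gt0.
have [C C0 fC] := fle _ e20.
have lnge (M : R) : \forall p \near +oo, M <= ln p.
  have : \forall p \near +oo, expR M <= p by exact: nbhs_pinfty_ge.
  apply: filterS => p Mp; rewrite -[M]expRK ler_ln// posrE ?expR_gt0//.
  exact: lt_le_trans (expR_gt0 M) Mp.
near=> p.
have p0 : 0 < p by near: p; exact: nbhs_pinfty_gt.
have l1 : 1 <= ln p by near: p; exact: lnge.
(* The tolerance [e] absorbs [ln c] on one side; on the other, half of it absorbs [ln C] and half
   the loss in the exponent. *)
have l2 : - ln c / e <= ln p by near: p; exact: lnge.
have l3 : ln C / (e / 2) <= ln p by near: p; exact: lnge.
have f1 : c * p `^ (- l) <= f p by near: p; exact: fge.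
have f2 : f p <= C * p `^ (- (l - e / 2)) by near: p; exact: fC.
have f0 : 0 < f p by apply: lt_le_trans f1; rewrite mulr_gt0// powR_gt0.
have lp0 : 0 < ln p by apply: lt_le_trans l1.
have := f1; rewrite -ler_ln ?posrE//; last by rewrite mulr_gt0// powR_gt0.
rewrite lnM ?posrE ?powR_gt0// ln_powR => g1.
have := f2; rewrite -ler_ln ?posrE//; last by rewrite mulr_gt0// powR_gt0.
rewrite lnM ?posrE ?powR_gt0// ln_powR => g2.
move: l2 l3; rewrite !ler_pdivrMr// => l2 l3.
have -> : l - - (ln (f p) / ln p) = (l * ln p + ln (f p)) / ln p.
  by field; exact: lt0r_neq0.
rewrite normrM normfV (gtr0_norm lp0) ler_pdivrMr// ler_norml.
by apply/andP; split; lra.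
Unshelve. all: by end_near. Qed.

(** * Gaussian probability of small discs *)

Lemma measurable_normsq (R : realType) :
  measurable_fun setT (normsq : R * R -> R).
Proof.
apply: measurable_funD; apply: measurable_funX.
  exact: measurable_fst.
exact: measurable_snd.
Qed.

Lemma measurable_normsq_le (R : realType) (u : R) :
  measurable [set z : R * R | normsq z <= u].
Proof.
rewrite -[X in measurable X]setTI.
by apply: measurable_fun_le => //; exact: measurable_normsq.
Qed.

Lemma leb2_square (R : realType) (a : R) : 0 <= a ->
  leb2 (`[- a, a]%classic `*` `[- a, a]%classic) = (4 * a ^+ 2)%:E.
Proof.
move=> a0; pose I : set R := `[- a, a]%classic.
transitivity (lebesgue_measure I * lebesgue_measure I)%E.
  by apply: product_measure1E; exact: measurable_itv.
rewrite lebesgue_measure_itv/= lte_fin.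
case: ltP => [_|aa]; first by rewrite -EFinB -EFinM; congr EFin; ring.
have -> : a = 0 by lra.
by rewrite mul0e expr0n/= mulr0.
Qed.

Section CN01.
Context {d} {T : measurableType d} {R : realType} (P : probability T R).
Context (Z : T -> R * R) (CNZ : is_CN01 P Z).

Let dens (z : R * R) : \bar R := (expR (- normsq z) / pi)%:E.

Let dens_ge0 z : (0 <= dens z)%E.
Proof. by rewrite lee_fin divr_ge0 ?expR_ge0// pi_ge0. Qed.

Let measurable_dens (A : set (R * R)) : measurable_fun A dens.
Proof.
apply: measurable_funTS; apply/measurable_EFinP; apply: measurable_funM => //.
apply: measurableT_comp => //; apply: measurableT_comp => //.
exact: measurable_normsq.
Qed.

(* The disc of squared radius u lies in a square of area 4u, and contains one
   of area 2u: this avoids integrating in polar coordinates. *)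
Lemma CN01_normsq_le (u : R) : 0 <= u ->
  (P (Z @^-1` [set z | (normsq z <= u)%R]) <= (4 * u)%:E)%E.
Proof.
move=> u0; rewrite CNZ; last exact: measurable_normsq_le.
set S := `[- Num.sqrt u, Num.sqrt u]%classic `*` `[- Num.sqrt u, Num.sqrt u]%classic.
have mS : measurable S by apply: measurableX.
have areaS : leb2 S = (4 * u)%:E by rewrite leb2_square ?sqrtr_ge0// sqr_sqrtr.
apply: (@le_trans _ _ (\int[leb2]_(z in S) dens z)%E).
  apply: ge0_subset_integral.
  - exact: measurable_normsq_le.
  - exact: mS.
  - exact: measurable_dens.
  - by move=> z _; exact: dens_ge0.
  move=> [x y]/=; rewrite /normsq/= => xyu.
  have sq (v : R) : v ^+ 2 <= u -> v \in `[- Num.sqrt u, Num.sqrt u].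
    by move=> vu; rewrite in_itv/= -ler_norml -sqrtr_sqr ler_wsqrtr.
  by split; apply: sq => /=; have := sqr_ge0 x; have := sqr_ge0 y; lra.
(* The density is at most [1 / pi], hence at most 1. *)
apply: (@le_trans _ _ (\int[leb2]_(z in S) cst 1%E z)%E).
  apply: ge0_le_integral.
  - exact: mS.
  - by move=> z _; exact: dens_ge0.
  - exact: measurable_dens.
  - exact: measurable_cst.
  move=> z _; rewrite lee_fin ler_pdivrMr ?pi_gt0// mul1r.
  apply: (@le_trans _ _ 1); last by have := pi_ge2 R; lra.
  by rewrite -expR0 ler_expR oppr_le0 addr_ge0 ?sqr_ge0.
by rewrite integral_cst// mul1e [leLHS]areaS.
Qed.

Lemma CN01_normsq_ge (u : R) : 0 <= u <= 1 ->
  ((2 * expR (-1) / pi * u)%:E <= P (Z @^-1` [set z | (normsq z <= u)%R]))%E.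
Proof.
(* Half the side of the square inscribed in the disc. Since [u <= 1], the density there is at least
   [expR (-1) / pi]. *)
move=> /andP[u0 u1]; set a := Num.sqrt (u / 2).
set S := `[- a, a]%classic `*` `[- a, a]%classic.
have a2 : a ^+ 2 = u / 2 by rewrite sqr_sqrtr// divr_ge0.
have mS : measurable S by apply: measurableX.
have areaS : leb2 S = (2 * u)%:E.
  by rewrite leb2_square ?sqrtr_ge0// a2; congr EFin; field.
have SB : S `<=` [set z | normsq z <= u].
  move=> [x y] [/=]; rewrite !in_itv/= -!ler_norml => xa ya.
  rewrite /normsq/=.
  have sq (v : R) : `|v| <= a -> v ^+ 2 <= u / 2.
    by move=> va; rewrite -a2 -real_normK ?num_real// lerXn2r ?nnegrE// sqrtr_ge0.
  by have := sq _ xa; have := sq _ ya; lra.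
rewrite CNZ; last exact: measurable_normsq_le.
apply: (@le_trans _ _ (\int[leb2]_(z in S) dens z)%E); last first.
  apply: ge0_subset_integral.
  - exact: mS.
  - exact: measurable_normsq_le.
  - exact: measurable_dens.
  - by move=> z _; exact: dens_ge0.
  - exact: SB.
apply: (@le_trans _ _ (\int[leb2]_(z in S) cst (expR (-1) / pi)%:E z)%E).
  rewrite integral_cst// [X in (_ * X)%E]areaS -EFinM lee_fin le_eqVlt.
  apply/orP; left; apply/eqP; move: (pi^-1) => q; ring.
apply: ge0_le_integral.
- exact: mS.
- by move=> z _; rewrite lee_fin divr_ge0 ?expR_ge0// pi_ge0.
- exact: measurable_cst.
- exact: measurable_dens.
move=> z Sz; rewrite lee_fin ler_pM2r ?invr_gt0 ?pi_gt0// ler_expR lerN2.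
by apply: le_trans u1; exact: SB.
Qed.
End CN01.

(** * Union bound and measurability of the outage event *)

Lemma union_bound {d} {T : measurableType d} {R : realType}
  (P : probability T R) (I : finType) (F : I -> set T) :
  (forall i, measurable (F i)) ->
  (P (\bigcup_i F i) <= \sum_i P (F i))%E.
Proof.
move=> mF; have -> : \bigcup_i F i = \big[setU/set0]_i F i.
  rewrite -bigcup_seq; apply: eq_bigcupl; split=> i //= _.
  exact: mem_index_enum.
elim: (index_enum I) => [|i s IH]; first by rewrite !big_nil measure0.
rewrite !big_cons; apply: le_trans (measureU2 _ _ _) _ => //.
  by apply: bigsetU_measurable => j _.
by rewrite leeD2l.
Qed.

(** A relay decodes exactly when [p * x i - tau] is positive, so the sum over the random decoding
    set is a sum of positive parts over all relays. The absolute value changes nothing, but makes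
    the denominator nonzero on the whole line, so that its inverse is continuous and measurability
    follows. *)
Lemma SNR_DB_max {T : Type} {R : realType} {N : nat} (Rt eta dist p : R)
    (hd : T -> R * R) (h g L : 'I_N -> T -> R * R) (t : T) : 0 < p ->
  SNR_DB Rt eta dist p hd h g L t =
  p * (normsq (hd t) / (1 + dist ^+ 2)) + eta * \sum_(i < N)
    normsq (g i t) / (1 + dist ^+ 2) *
    Num.max (p * (normsq (h i t) / (1 + `|normsq (L i t)|)) - tau_of Rt) 0.
Proof.
move=> p0; rewrite /SNR_DB big_mkcond/=; congr (_ + _ * _).
apply: eq_bigr => i _; rewrite (ger0_norm (addr_ge0 (sqr_ge0 _) (sqr_ge0 _))).
rewrite ltr_pdivrMr// (mulrC _ p) -subr_gt0.
by case: ltP => // _; rewrite mulr0.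
Qed.

Lemma measurable_SNR_DB {d} {T : measurableType d} {R : realType} {N : nat}
    (Rt eta dist p : R) (hd : T -> R * R) (h g L : 'I_N -> T -> R * R) :
  0 < p -> measurable_fun setT hd ->
  (forall i, measurable_fun setT (h i)) ->
  (forall i, measurable_fun setT (g i)) ->
  (forall i, measurable_fun setT (L i)) ->
  measurable_fun setT (SNR_DB Rt eta dist p hd h g L).
Proof.
move=> p0 mhd mh mg mL.
have mnormsq (f : T -> R * R) : measurable_fun setT f ->
    measurable_fun setT (fun t => normsq (f t)).
  by move=> mf; apply: measurableT_comp mf; exact: measurable_normsq.
rewrite (funext (fun t => SNR_DB_max Rt eta dist p hd h g L t p0)).
apply: measurable_funD.
  apply: measurable_funM => //; apply: measurable_funM => //.
  exact: mnormsq.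
apply: measurable_funM => //; apply: measurable_sum => i.
apply: measurable_funM.
  by apply: measurable_funM => //; exact: mnormsq.
apply: measurable_maxr => //; apply: measurable_funB => //.
apply: measurable_funM => //; apply: measurable_funM; first exact: mnormsq.
apply: (@measurableT_comp _ _ _ _ _ _ (fun u : R => (1 + `|u|)^-1)); last exact: mnormsq.
apply: continuous_measurable_fun => u; apply: cvgV.
  by rewrite lt0r_neq0// ltr_pwDl.
by apply: cvgD; [exact: cvg_cst|exact: norm_continuous].
Qed.

Lemma measurable_outage {d} {T : measurableType d} {R : realType} {N : nat}
    (Rt eta dist p : R) (hd : T -> R * R) (h g L : 'I_N -> T -> R * R) :
  0 < p -> measurable_fun setT hd ->
  (forall i, measurable_fun setT (h i)) ->
  (forall i, measurable_fun setT (g i)) ->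
  (forall i, measurable_fun setT (L i)) ->
  measurable [set t | SNR_DB Rt eta dist p hd h g L t < tau_of Rt].
Proof.
move=> p0 mhd mh mg mL; rewrite -[X in measurable X]setTI.
have mS := measurable_SNR_DB Rt eta dist p hd h g L p0 mhd mh mg mL.
have mlt : measurable_fun setT
    (fun t => SNR_DB Rt eta dist p hd h g L t < tau_of Rt).
  exact: measurable_fun_ltr.
exact: (mlt measurableT [set true]).
Qed.

(** * Product events under independence *)

Section independence.
Context {d} {T : measurableType d} {R : realType} (P : probability T R).
Context {N : nat} (hd : T -> R * R) (h g L : 'I_N -> T -> R * R).
Context (mhd : measurable_fun setT hd) (mh : forall i, measurable_fun setT (h i))
  (mg : forall i, measurable_fun setT (g i))
  (mL : forall i, measurable_fun setT (L i)).

(** The common shape of the event that bounds outage from below and of the rectangles that cover it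
    from above. *)
Definition box (B0 : set (R * R)) (Bh Bg BL : 'I_N -> set (R * R)) : set T :=
  hd @^-1` B0 `&` \bigcap_i
    (h i @^-1` Bh i `&` (g i @^-1` Bg i `&` L i @^-1` BL i)).

Lemma measurable_preim (f : T -> R * R) B :
  measurable_fun setT f -> measurable B -> measurable (f @^-1` B).
Proof. by move=> mf mB; rewrite -[X in measurable X]setTI; exact: mf. Qed.

Context (B0 : set (R * R)) (Bh Bg BL : 'I_N -> set (R * R)).
Context (mB0 : measurable B0) (mBh : forall i, measurable (Bh i))
  (mBg : forall i, measurable (Bg i)) (mBL : forall i, measurable (BL i)).

Lemma measurable_box : measurable (box B0 Bh Bg BL).
Proof.
apply: measurableI; first exact: measurable_preim.
apply: fin_bigcap_measurable => [|i _]; first exact: finite_finset.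
by do !apply: measurableI; apply: measurable_preim.
Qed.

Lemma fine_box : mutually_independent P (relay_family hd h g L) ->
  fine (P (box B0 Bh Bg BL)) =
  fine (P (hd @^-1` B0)) * \prod_i (fine (P (h i @^-1` Bh i)) *
    (fine (P (g i @^-1` Bg i)) * fine (P (L i @^-1` BL i)))).
Proof.
move=> indep; pose B (k : option ('I_3 * 'I_N)) := match k with
  | None => B0
  | Some (j, i) => if nat_of_ord j == 0%N then Bh i
                   else if nat_of_ord j == 1%N then Bg i else BL i
  end.
have mB k : measurable (B k).
  by case: k => [[j i]|]//=; case: ifP => // _; case: ifP.
have -> : box B0 Bh Bg BL =
    \bigcap_(k in [set: option ('I_3 * 'I_N)]) (relay_family hd h g L k @^-1` B k).
  apply/seteqP; split=> t.
    move=> [t0 ti] [[j i]|] _//=; have [th [tg tL]] := ti i I.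
    by case: ifP => // _; case: ifP.
  move=> tB; split; first exact: (tB None).
  move=> i _; split; first exact: (tB (Some (@Ordinal 3 0 isT, i))).
  by split; [exact: (tB (Some (@Ordinal 3 1 isT, i)))
            |exact: (tB (Some (@Ordinal 3 2 isT, i)))].
rewrite indep//.
have mF k : measurable (relay_family hd h g L k @^-1` B k).
  apply: measurable_preim => //.
  by case: k => [[j i]|]//=; case: ifP => // _; case: ifP.
rewrite (eq_bigr (fun k => (fine (P (relay_family hd h g L k @^-1` B k)))%:E)).
  rewrite prodEFin/= (bigD1 None)//=; congr (_ * _).
  (* With the factor of [hd] split off, the indices left are pairs [(j, i)]; the product over them
     is cut into one product for each of the three kinds of variable, and these are merged relay by
     relay. *)
  rewrite (reindex_omap Some id)/=; last by case.
  rewrite (eq_bigl xpredT) => [|k]; last by rewrite eqxx.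
  transitivity (\prod_(j < 3) \prod_(i < N)
      fine (P (relay_family hd h g L (Some (j, i)) @^-1` B (Some (j, i))))).
    by rewrite pair_big/=; apply: eq_bigr => -[].
  by rewrite !big_ord_recl big_ord0/= mulr1 -!big_split/=.
by move=> k _; rewrite fineK// fin_num_measure.
Qed.

End independence.

(** * Pointwise consequences of outage *)

(** Written with positive parts, all terms are nonnegative, so each is below the total. Dropping the
    positive part only decreases a term, so the bound covers relays that do not decode as well. *)
Lemma SNR_DB_lt_terms {T : Type} {R : realType} {N : nat} (Rt eta dist p : R)
    (hd : T -> R * R) (h g L : 'I_N -> T -> R * R) (t : T) :
  0 < p -> 0 < eta -> SNR_DB Rt eta dist p hd h g L t < tau_of Rt ->
  p * (normsq (hd t) / (1 + dist ^+ 2)) < tau_of Rt /\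
  forall i, eta * (normsq (g i t) / (1 + dist ^+ 2) *
    (p * (normsq (h i t) / (1 + normsq (L i t))) - tau_of Rt)) < tau_of Rt.
Proof.
move=> p0 eta0; rewrite SNR_DB_max//.
have nge0 (z : R * R) : 0 <= normsq z by rewrite addr_ge0 ?sqr_ge0.
have D0 : 0 <= (1 + dist ^+ 2)^-1 by rewrite invr_ge0 addr_ge0 ?sqr_ge0.
pose F (i : 'I_N) := normsq (g i t) / (1 + dist ^+ 2) *
  Num.max (p * (normsq (h i t) / (1 + `|normsq (L i t)|)) - tau_of Rt) 0.
have F0 i : 0 <= F i.
  by rewrite /F mulr_ge0 ?le_max ?lexx ?orbT// mulr_ge0.
have first0 : 0 <= p * (normsq (hd t) / (1 + dist ^+ 2)).
  by rewrite !mulr_ge0// ltW.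
have S0 : 0 <= \sum_(i < N) F i by apply: sumr_ge0.
have etaS0 : 0 <= eta * \sum_(i < N) F i by rewrite mulr_ge0// ltW.
move=> lt_tau; split=> [|i]; first lra.
apply: (@le_lt_trans _ _ (eta * \sum_(i < N) F i)); last lra.
rewrite ler_pM2l// (bigD1 i)//=; apply: (@le_trans _ _ (F i)).
  rewrite /F ger0_norm//; apply: ler_wpM2l; first by rewrite mulr_ge0.
  by rewrite le_max lexx.
by rewrite lerDl; apply: sumr_ge0.
Qed.

(** Here [U], [V], [l] stand for the squared norms of [h i], [g i], [L i]. If [p * x <= 2 * tau],
    then [U] is of order [1 / p]. Otherwise [p * x - tau] exceeds [p * x / 2], and the hypothesis
    bounds [V * (p * x)]. The constant [c] adds the two bounds so as to serve both cases. *)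
Lemma relay_product_le (R : realType) (tau eta dist RD p U V l : R) :
  0 < tau -> 0 < eta -> 0 < p -> 0 <= V -> 0 <= l <= RD ^+ 2 ->
  eta * (V / (1 + dist ^+ 2) * (p * (U / (1 + l)) - tau)) < tau ->
  let c := (1 + RD ^+ 2) * (2 * tau + 2 * tau * (1 + dist ^+ 2) / eta) in
  U <= c / p \/ U * V <= c / p.
Proof.
move=> tau0 eta0 p0 V0 /andP[l0 lRD].
have D0 : 0 < 1 + dist ^+ 2 by rewrite ltr_wpDr ?sqr_ge0.
have l10 : 0 < 1 + l by lra.
set D := 1 + dist ^+ 2 in D0 *; set x := U / (1 + l) => lt_tau c.
have Ux : U = x * (1 + l) by rewrite /x divfK// lt0r_neq0.
have lRD1 : 1 + l <= 1 + RD ^+ 2 by lra.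
have q0 : 0 <= 2 * tau * D / eta.
  by rewrite divr_ge0 ?(ltW eta0)// !mulr_ge0// ltW.
have scale (w y : R) : 0 <= y -> w <= y -> w * (1 + l) <= (1 + RD ^+ 2) * y.
  move=> y0 wy; apply: (@le_trans _ _ (y * (1 + l))).
    by rewrite ler_wpM2r// ltW.
  by rewrite mulrC ler_wpM2r.
rewrite !ler_pdivlMr//.
have [pxle|pxgt] := leP (p * x) (2 * tau).
  left; rewrite (_ : U * p = p * x * (1 + l)); last by rewrite Ux; ring.
  by apply: scale; lra.
right; rewrite (_ : U * V * p = V * (p * x) * (1 + l)); last by rewrite Ux; ring.
apply: scale; first lra.
apply: (@le_trans _ _ (2 * tau * D / eta)); last lra.
rewrite ler_pdivlMr//.
have le1 : eta * (V / D) * (p * x / 2) <= eta * (V / D) * (p * x - tau).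
  by rewrite ler_wpM2l ?mulr_ge0 ?invr_ge0 ?(ltW D0) ?(ltW eta0)//; lra.
have le2 : eta * (V / D) * (p * x / 2) < tau.
  by apply: le_lt_trans le1 _; rewrite -mulrA.
have -> : V * (p * x) * eta = eta * (V / D) * (p * x / 2) * (2 * D).
  by field; rewrite lt0r_neq0.
rewrite (_ : 2 * tau * D = tau * (2 * D)); last by ring.
by rewrite ler_wpM2r ?mulr_ge0 ?(ltW D0)// ltW.
Qed.

(** Locate [U] between consecutive powers, [r ^+ j.+1 < U <= r ^+ j], with no upper constraint when
    [j = 0]. Then [V > r ^+ (k - j)] would force [U * V > r ^+ k.+1]. *)
Lemma geometric_cover (R : realDomainType) (r U V : R) (k : nat) :
  0 < r -> 0 <= U -> 0 <= V -> U <= r ^+ k.+1 \/ U * V <= r ^+ k.+1 ->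
  exists j : 'I_k.+2, ((j == 0%N :> nat) || (U <= r ^+ j)) &&
    ((k - j == 0)%N || (V <= r ^+ (k - j))).
Proof.
move=> r0 U0 V0 UV; have [Ule|Ugt] := leP U (r ^+ k.+1).
  (* At the last index [j = k.+1] the truncated difference [k - j] is 0, so [V] is unconstrained. *)
  by exists ord_max; rewrite /= Ule subnS subnn.
case: UV => [|UV]; first by rewrite leNgt Ugt.
(* Descend from [n] until [U] is at most the current power or the exponent reaches 0. *)
have level n : r ^+ n.+1 < U ->
    exists2 j, (j <= n)%N & ((j == 0%N) || (U <= r ^+ j)) && (r ^+ j.+1 < U).
  elim: n => [|n IH] Un; first by exists 0%N; rewrite ?eqxx.
  have [Un1|/IH[j jn jP]] := leP U (r ^+ n.+1).
    by exists n.+1; rewrite ?Un1.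
  by exists j => //; exact: leqW.
have [j jk /andP[jU Uj]] := level _ Ugt.
have jk2 : (j < k.+2)%N by rewrite ltnS leqW.
exists (Ordinal jk2) => /=; rewrite jU; apply/orP; right; rewrite leNgt; apply/negP => Vj.
have : r ^+ j.+1 * r ^+ (k - j) < U * V.
  by apply: ltr_pM => //; rewrite exprn_ge0// ltW.
by rewrite -exprD addSn subnKC// ltNge UV.
Qed.

(* The constraint is void for n = 0, since |z|^2 <= 1 would leave large values of
   |h_i|^2 or |g_i|^2 uncovered. *)
Definition pball {R : realType} (r : R) (n : nat) : set (R * R) :=
  [set z | (n == 0%N) || (normsq z <= r ^+ n)].

Lemma measurable_pball (R : realType) (r : R) n : measurable (pball r n).
Proof.
rewrite /pball; case: eqP => _ /=; last exact: measurable_normsq_le.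
by rewrite (_ : mkset _ = setT) //; apply/seteqP.
Qed.

(** * Lower and upper bounds on the outage probability *)

Section outage_bounds.
Context {d} {T : measurableType d} {R : realType} (P : probability T R).
Context {N : nat} (RD dist Rt eta : R).
Context (hd : T -> R * R) (h g L : 'I_N -> T -> R * R).
Context (dist0 : 0 < dist) (Rt0 : 0 < Rt) (eta0 : 0 < eta).
Context (mhd : measurable_fun setT hd).
Context (mh : forall i, measurable_fun setT (h i)).
Context (mg : forall i, measurable_fun setT (g i)).
Context (mL : forall i, measurable_fun setT (L i)).
Context (indep : mutually_independent P (relay_family hd h g L)).
Context (CNhd : is_CN01 P hd).
Context (CNh : forall i, is_CN01 P (h i)).
Context (CNg : forall i, is_CN01 P (g i)).
Context (unifL : forall i, is_unif_disc P RD (L i)).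

Let tau := tau_of Rt.
Let out p := outage P Rt eta dist p hd h g L.

Lemma tau_gt0 : 0 < tau.
Proof.
rewrite subr_gt0 -[ltLHS](congr1 (@^~ (2 * Rt)) (powR1 R)).
by apply: gt0_ltr_powR; rewrite ?nnegrE ?mulr_gt0// ltr1n.
Qed.

Let fineP_le (A : set T) (x : R) : measurable A -> (P A <= x%:E)%E -> fine (P A) <= x.
Proof. by move=> mA; rewrite -[X in (X <= _)%E]fineK ?fin_num_measure// lee_fin. Qed.

Let fineP_ge (A : set T) (x : R) : measurable A -> (x%:E <= P A)%E -> x <= fine (P A).
Proof. by move=> mA; rewrite -[X in (_ <= X)%E]fineK ?fin_num_measure// lee_fin. Qed.

Let prob_le1 (A : set T) : measurable A -> fine (P A) <= 1.
Proof. by move=> mA; apply: fineP_le => //; exact: probability_le1. Qed.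

Let fine_ge0P (A : set T) : 0 <= fine (P A).
Proof. exact: fine_ge0. Qed.

Lemma outage_ge : exists2 c, 0 < c &
  \forall p \near +oo, c * p `^ (- N.+1%:R) <= out p.
Proof.
set a := 2 * expR (-1) / pi : R.
have a0 : 0 < a by rewrite divr_gt0 ?pi_gt0// mulr_gt0 ?expR_gt0.
(* Each of the [N.+1] Gaussian constraints has probability at least [a * (tau / p)] once
   [tau <= p]. *)
exists ((a * tau) ^+ N.+1); first by rewrite exprn_gt0// mulr_gt0// tau_gt0.
have pnear : \forall p \near +oo, tau <= p by exact: (nbhs_pinfty_ge (num_real _)).
apply: filterS pnear => p taup.
have p0 : 0 < p := lt_le_trans tau_gt0 taup.
pose B := [set z : R * R | normsq z <= tau / p].
have mB : measurable B := measurable_normsq_le _ _.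
have tp : 0 <= tau / p <= 1.
  by rewrite divr_ge0 ?(ltW tau_gt0) ?(ltW p0)//= ler_pdivrMr// mul1r.
have PB (f : T -> R * R) : measurable_fun setT f -> is_CN01 P f ->
    a * (tau / p) <= fine (P (f @^-1` B)).
  by move=> mf CNf; apply: fineP_ge; [exact: measurable_preim|exact: CN01_normsq_ge].
have mbox : measurable (box hd h g L B (fun=> B) (fun=> setT) (fun=> setT)).
  by apply: measurable_box.
(* Path loss only reduces the gains, so no relay passes the threshold [tau / p]; the direct term is
   strictly below [tau] because [1 + dist ^+ 2 > 1]. *)
have sub : box hd h g L B (fun=> B) (fun=> setT) (fun=> setT) `<=`
    [set t | SNR_DB Rt eta dist p hd h g L t < tau_of Rt].
  move=> t [/= t0 ti]; rewrite /SNR_DB big_pred0 => [|i].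
    rewrite mulr0 addr0 mulrA ltr_pdivrMr ?ltr_wpDr ?sqr_ge0//.
    rewrite mulrC; apply: (@le_lt_trans _ _ tau); first by rewrite -ler_pdivlMr//; exact: t0.
    by rewrite ltr_pMr ?tau_gt0// ltrDl exprn_gt0.
  apply/negbTE; rewrite -leNgt.
  have [hi _] := ti i I.
  apply: le_trans hi; rewrite ler_pdivrMr ?ltr_wpDr ?addr_ge0 ?sqr_ge0//.
  by rewrite ler_peMr ?lerDl ?addr_ge0 ?sqr_ge0.
apply: (@le_trans _ _ (fine (P (box hd h g L B (fun=> B) (fun=> setT) (fun=> setT))))).
  rewrite fine_box// powR_invn ?(ltW p0)// -exprVn -exprMn exprS -(mulrA a).
  have atp0 : 0 <= a * (tau / p) by rewrite mulr_ge0 ?(ltW a0)//; case/andP: tp.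
  apply: ler_pM => //; first by rewrite exprn_ge0.
    exact: PB.
  rewrite -[X in _ ^+ X](card_ord N) -prodr_const; apply: ler_prod => i _.
  by rewrite atp0 !preimage_setT probability_setT/= !mulr1 PB.
apply: fine_le; rewrite ?fin_num_measure//; first exact: measurable_outage.
by apply: le_measure; rewrite ?inE//; exact: measurable_outage.
Qed.

Lemma prob_pball (f : T -> R * R) (r : R) n : 0 <= r ->
  measurable_fun setT f -> is_CN01 P f ->
  fine (P (f @^-1` pball r n)) <= 4 * r ^+ n.
Proof.
(* With [n = 0] the event is certain and the bound is 4. *)
move=> r0 mf CNf; have [->|n0] := eqVneq n 0%N.
  rewrite expr0 mulr1; apply: le_trans (prob_le1 _ _) _; last lra.
  by apply: measurable_preim => //; exact: measurable_pball.
apply: fineP_le; first by apply: measurable_preim => //; exact: measurable_pball.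
rewrite (_ : pball r n = [set z | normsq z <= r ^+ n]).
  by apply: CN01_normsq_le => //; rewrite exprn_ge0.
by rewrite /pball (negbTE n0).
Qed.

Lemma prob_out_disc i : fine (P (L i @^-1` (~` disc RD))) = 0.
Proof.
rewrite unifL; last by apply: measurableC; exact: measurable_normsq_le.
have leb0 : leb2 (set0 : set (R * R)) = 0%E by rewrite /leb2; exact: measure0.
by rewrite setICl leb0 mul0e.
Qed.

(* The rectangle [None] takes care of the null event that a relay lies outside
   the disc. *)
Let coverh (r : R) k (j : option 'I_k.+2) := if j is Some j then pball r j else setT.
Let coverg (r : R) k (j : option 'I_k.+2) :=
  if j is Some j then pball r (k - j) else setT.
Let coverL k (j : option 'I_k.+2) := if j is Some _ then setT else ~` disc RD.

Let measurable_coverh r k j : measurable (@coverh r k j).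
Proof. by case: j => [j|]; [exact: measurable_pball|exact: measurableT]. Qed.

Let measurable_coverg r k j : measurable (@coverg r k j).
Proof. by case: j => [j|]; [exact: measurable_pball|exact: measurableT]. Qed.

Let measurable_coverL k j : measurable (@coverL k j).
Proof.
case: j => [j|]; first exact: measurableT.
by apply: measurableC; exact: measurable_normsq_le.
Qed.

(** The exponents satisfy [k <= j + (k - j)] even at [j = k.+1], where the difference truncates, and
    [r <= 1]. The index [None] contributes probability 0. *)
Lemma cover_prob_le (r : R) k (i : 'I_N) j : 0 <= r <= 1 ->
  fine (P (h i @^-1` coverh r k j)) *
    (fine (P (g i @^-1` coverg r k j)) * fine (P (L i @^-1` coverL k j)))
  <= 16 * r ^+ k.
Proof.
move=> /andP[r0 r1]; case: j => [j|]/=; last first.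
  by rewrite prob_out_disc !mulr0 mulr_ge0// exprn_ge0.
rewrite preimage_setT probability_setT mulr1.
apply: (@le_trans _ _ (4 * r ^+ j * (4 * r ^+ (k - j)))).
  by apply: ler_pM; rewrite ?fine_ge0P//; apply: prob_pball.
rewrite mulrACA -exprD -natrM ler_wpM2l// ler_wiXn2l//.
by rewrite -leq_subLR.
Qed.

Lemma outage_le k : exists2 C, 0 < C & \forall p \near +oo,
  out p <= C * p `^ (- (1 + N%:R * (k%:R / k.+1%:R))).
Proof.
(* [c] is the constant of [relay_product_le]; [b / p] bounds the squared norm of [hd] through the
   direct link. *)
pose c := (1 + RD ^+ 2) * (2 * tau + 2 * tau * (1 + dist ^+ 2) / eta).
pose b := tau * (1 + dist ^+ 2).
have t0 := tau_gt0.
have D0 : 0 < 1 + dist ^+ 2 by rewrite ltr_wpDr ?sqr_ge0.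
have b0 : 0 < b by rewrite mulr_gt0.
have c0 : 0 < c.
  apply: mulr_gt0; first by rewrite ltr_wpDr ?sqr_ge0.
  by apply: addr_gt0; rewrite ?divr_gt0 ?mulr_gt0.
set kap := k%:R / k.+1%:R : R.
(* There are [k.+3] choices per relay, the [k.+2] rectangles and [None]; the other factors bound the
   probability of one choice. *)
exists (4 * b * (k.+3%:R * (16 * c `^ kap)) ^+ N).
  by rewrite !mulr_gt0 ?exprn_gt0 ?mulr_gt0 ?powR_gt0// ltr0n.
have pnear : \forall p \near +oo, c <= p by exact: (nbhs_pinfty_ge (num_real _)).
apply: filterS pnear => p cp.
have p0 : 0 < p := lt_le_trans c0 cp.
(* The root for which [r ^+ k.+1 = c / p]; it is at most 1 because [c <= p]. *)
pose r := (c / p) `^ k.+1%:R^-1.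
have cp0 : 0 < c / p by rewrite divr_gt0.
have cp1 : c / p <= 1 by rewrite ler_pdivrMr// mul1r.
have r0 : 0 < r by rewrite powR_gt0.
have r1 : r <= 1.
  by rewrite -(powRr0 (c / p)) ger_powR ?cp0// invr_ge0 ler0n.
have rX n : r ^+ n = (c / p) `^ (n%:R / k.+1%:R).
  by rewrite -powR_mulrn ?ltW// /r -powRrM (mulrC _ n%:R).
have rk1 : r ^+ k.+1 = c / p by rewrite rX divff ?pnatr_eq0// powRr1// ltW.
pose B := [set z : R * R | normsq z <= b / p].
(* [phi] selects one rectangle for each relay. *)
pose bx (phi : {ffun 'I_N -> option 'I_k.+2}) := box hd h g L B
  (fun i => coverh r k (phi i)) (fun i => coverg r k (phi i))
  (fun i => coverL k (phi i)).
have mbx phi : measurable (bx phi).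
  by apply: measurable_box => //; exact: measurable_normsq_le.
have sub : [set t | SNR_DB Rt eta dist p hd h g L t < tau_of Rt] `<=`
    \bigcup_phi bx phi.
  move=> t /= /(SNR_DB_lt_terms _ _ _ _ _ _ _ _ _ p0 eta0)[lt0 lti].
  have ci i : exists j, [/\ coverh r k j (h i t), coverg r k j (g i t)
                          & coverL k j (L i t)].
    have [Lin|Lout] := leP (normsq (L i t)) (RD ^+ 2); last first.
      by exists None; split=> //=; apply/negP; rewrite -ltNge.
    have nge0 (z : R * R) : 0 <= normsq z by rewrite addr_ge0 ?sqr_ge0.
    have UV : normsq (h i t) <= c / p \/ normsq (h i t) * normsq (g i t) <= c / p.
      by apply: (relay_product_le _ tau _ _ _ _ _ _ (normsq (L i t))) => //;
        rewrite ?nge0 ?Lin//; exact: lti.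
    rewrite -rk1 in UV.
    have [j /andP[hj gj]] := geometric_cover _ _ _ _ _ r0 (nge0 _) (nge0 _) UV.
    by exists (Some j).
  have [phi phiP] := choice ci.
  exists [ffun i => phi i] => //; split=> /=.
    rewrite /preimage /B/= ler_pdivlMr// mulrC /b.
    by move: lt0; rewrite mulrA ltr_pdivrMr// => /ltW.
  by move=> i _; rewrite !ffunE; have [? ? ?] := phiP i.
have mout := measurable_outage Rt eta dist p hd h g L p0 mhd mh mg mL.
have outE : out p <= \sum_phi fine (P (bx phi)).
  apply: fineP_le => //; apply: le_trans (le_measure _ _ _ sub) _.
  - by rewrite inE.
  - by rewrite inE; apply: fin_bigcup_measurable => //; exact: finite_finset.
  rewrite -sumEFin; apply: le_trans (union_bound _ _ _ mbx) _.
  by apply: lee_sum => phi _; rewrite fineK// fin_num_measure.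
have bxle phi : fine (P (bx phi)) <= 4 * (b / p) * (16 * r ^+ k) ^+ N.
  rewrite fine_box//; last exact: measurable_normsq_le.
  apply: ler_pM; rewrite ?fine_ge0P//.
  - by apply: prodr_ge0 => i _; rewrite !mulr_ge0 ?fine_ge0P.
  - apply: fineP_le.
      by apply: measurable_preim => //; exact: measurable_normsq_le.
    by apply: CN01_normsq_le => //; rewrite divr_ge0// ltW.
  rewrite -[X in _ <= _ ^+ X](card_ord N) -prodr_const; apply: ler_prod => i _.
  by rewrite !mulr_ge0 ?fine_ge0P//= cover_prob_le// r1 ltW.
apply: (le_trans outE); apply: le_trans (ler_sum _ (fun phi _ => bxle phi)) _.
rewrite sumr_const card_ffun card_option !card_ord -[leLHS]mulr_natr natrX rX -/kap.
rewrite powRM ?(ltW c0) ?invr_ge0 ?(ltW p0)//.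
rewrite powRN powRD ?(gt_eqF p0) ?implybT// powRr1 ?(ltW p0)//.
rewrite (mulrC N%:R) (powRrM p) powR_mulrn ?powR_ge0//.
have -> : p^-1 `^ kap = (p `^ kap)^-1.
  by rewrite -[p^-1]powR_inv1 ?(ltW p0)// -powRrM mulN1r powRN.
rewrite !exprMn exprVn invfM le_eqVlt; apply/orP; left; apply/eqP; ring.
Qed.

End outage_bounds.

(** * The diversity gain *)

Theorem theorem3 (R : realType) (d : measure_display) (T : measurableType d)
  (P : probability T R) (N : nat) (RD dist Rt eta : R)
  (hd : T -> R * R) (h g L : 'I_N -> T -> R * R) :
  (0 < N)%N -> 0 < RD -> 0 < dist -> 0 < Rt -> 0 < eta -> eta <= 1 ->
  measurable_fun setT hd ->
  (forall i, measurable_fun setT (h i)) ->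
  (forall i, measurable_fun setT (g i)) ->
  (forall i, measurable_fun setT (L i)) ->
  mutually_independent P (relay_family hd h g L) ->
  is_CN01 P hd ->
  (forall i, is_CN01 P (h i)) ->
  (forall i, is_CN01 P (g i)) ->
  (forall i, is_unif_disc P RD (L i)) ->
  - (ln (outage P Rt eta dist p hd h g L) / ln p) @[p --> +oo] --> (N.+1%:R : R).
Proof.
move=> _ RD0 dist0 Rt0 eta0 _ mhd mh mg mL indep CNhd CNh CNg unifL.
have [c c0 c_le] : exists2 c, 0 < c & \forall p \near +oo,
    c * p `^ (- N.+1%:R) <= outage P Rt eta dist p hd h g L.
  exact: outage_ge.
apply: (cvg_opp_ln_div_ln _ _ _ _ c0 c_le) => e e0.
(* The exponent of the upper bound falls short of [N.+1] by [N / (k + 1)], which this [k] makes at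
   most [e]. *)
have [k Nk] : exists k, N%:R / e <= k.+1%:R.
  exists (Num.truncn (N%:R / e)).
  by apply/ltW; rewrite truncnS_gt.
have [C C0 le_C] : exists2 C, 0 < C & \forall p \near +oo,
    outage P Rt eta dist p hd h g L <=
      C * p `^ (- (1 + N%:R * (k%:R / k.+1%:R))).
  exact: outage_le.
exists C => //; near=> p.
apply: (@le_trans _ _ (C * p `^ (- (1 + N%:R * (k%:R / k.+1%:R))))).
  by near: p.
have p1 : 1 <= p by near: p; exact: nbhs_pinfty_ge.
rewrite ler_pM2l// ler_powR// lerN2.
move: Nk; rewrite ler_pdivrMr// => Nk.
rewrite -[N.+1]addn1 natrD.
have -> : k%:R / k.+1%:R = 1 - k.+1%:R^-1 :> R.
  have k1 : k.+1%:R != 0 :> R by rewrite pnatr_eq0.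
  by apply: (mulIf k1); rewrite mulrBl mul1r divfK// mulVf// -[k.+1]addn1 natrD addrK.
rewrite mulrBr mulr1.
suff : N%:R / k.+1%:R <= e by move: (_ / _) => q; lra.
by rewrite ler_pdivrMr ?ltr0n// mulrC.
Unshelve. all: by end_near. Qed.
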